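(* If $G$ is a low-betweenness BUG, then its complement $\overline{G}$ has fewer edges than vertices, i.e. $|E(\overline{G})|<|V(\overline{G})|$.
   Context: All graphs are finite, simple, undirected, with nonempty vertex set; $\overline{G}$ denotes the complement of $G$. For distinct vertices $v,w$ of a connected graph $G$, let $\sigma_{vw}$ be the number of shortest paths between $v$ and $w$, and $\sigma_{vw}(x)$ the number of those containing $x$ as an internal vertex (so $\sigma_{vw}(x)=0$ if $x\in\{v,w\}$). The betweenness of a vertex $x$ is $B_G(x)=\sum_{\{v,w\}\subseteq V(G)}\frac{\sigma_{vw}(x)}{\sigma_{vw}}$, the sum being over unordered pairs of distinct vertices. A betweenness-uniform graph (BUG) is a connected graph $G$ in which all vertices have the same betweenness; this common value is the betweenness of $G$. A low-betweenness BUG is a BUG with betweenness smaller than $1$. *)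

(* Defs.v *)
From mathcomp Require Import all_boot all_order all_algebra.

Set Implicit Arguments.
Unset Strict Implicit.
Unset Printing Implicit Defensive.

Record sgraph := SGraph {
  vertex :> finType;
  adj : rel vertex;
  adj_sym : symmetric adj;
  adj_irr : irreflexive adj;
  vertex_gt0 : 0 < #|vertex|
}.

Definition compl_adj (G : sgraph) : rel G :=
  fun v w => (v != w) && ~~ adj v w.

Lemma compl_adj_sym (G : sgraph) : symmetric (@compl_adj G).
Proof. by move=> v w; rewrite /compl_adj eq_sym adj_sym. Qed.

Lemma compl_adj_irr (G : sgraph) : irreflexive (@compl_adj G).
Proof. by move=> v; rewrite /compl_adj eqxx. Qed.

Definition complement (G : sgraph) : sgraph :=
  SGraph (@compl_adj_sym G) (@compl_adj_irr G) (vertex_gt0 G).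

Definition edges (G : sgraph) : {set {set G}} :=
  [set [set p.1; p.2] | p : G * G & adj p.1 p.2].

Definition connected (G : sgraph) : Prop :=
  forall v w : G, connect (@adj G) v w.

(* [p] lists the vertices of the path after its starting point [v], so that
   [size p] is the length of the path. *)
Definition is_path (G : sgraph) (v w : G) (p : seq G) : bool :=
  [&& path (@adj G) v p, last v p == w & uniq (v :: p)].

(* A path has fewer than #|G| edges, so the search range is exhaustive;
   the value is #|G| when there is no path from [v] to [w]. *)
Definition dist (G : sgraph) (v w : G) : nat :=
  find (fun n => [exists p : n.-tuple G, is_path v w p]) (iota 0 #|G|).

Definition shortest_paths (G : sgraph) (v w : G) :
    {set (dist v w).-tuple G} :=
  [set p : (dist v w).-tuple G | is_path v w p].

Definition sigma (G : sgraph) (v w : G) : nat := #|shortest_paths v w|.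

Definition sigma_through (G : sgraph) (v w x : G) : nat :=
  #|[set p in shortest_paths v w | [&& x \in v :: p, x != v & x != w]]|.

(* Each unordered pair {v, w} is represented by the ordered pair that is
   increasing for the enumeration of the vertices; the choice is immaterial
   by [sigmaC] and [sigma_throughC]. *)
Definition betweenness (G : sgraph) (x : G) : rat :=
  (\sum_(v : G) \sum_(w : G | (enum_rank v < enum_rank w)%N)
     (sigma_through v w x)%:R / (sigma v w)%:R)%R.

Definition bug_of_betweenness (G : sgraph) (b : rat) : Prop :=
  connected G /\ forall x : G, betweenness x = b.

Definition low_betweenness_bug (G : sgraph) : Prop :=
  exists b : rat, bug_of_betweenness G b /\ (b < 1)%R.

Lemma is_path_rev (G : sgraph) (v w : G) (p : seq G) :
  is_path v w p -> is_path w v (rev (belast v p)).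
Proof.
case/and3P=> pp /eqP lp up; apply/and3P; split.
- rewrite -lp rev_path (eq_path (e' := @adj G)) // => a b.
  exact: adj_sym.
- by case: p {pp up} lp => [|a p] /= lp; rewrite ?lp // rev_cons last_rcons.
- by rewrite -lp -rev_rcons -lastI rev_uniq.
Qed.

Lemma distC (G : sgraph) (v w : G) : dist v w = dist w v.
Proof.
apply: eq_find => n.
apply/existsP/existsP => -[p /is_path_rev pp].
  by exists [tuple of rev (belast v p)].
by exists [tuple of rev (belast w p)].
Qed.

Lemma card_pathsC (G : sgraph) (v w : G) n (P : pred G) :
  #|[set p : n.-tuple G | is_path v w p & has P (v :: p)]| =
  #|[set p : n.-tuple G | is_path w v p & has P (w :: p)]|.
Proof.
suff le a b : #|[set p : n.-tuple G | is_path a b p & has P (a :: p)]| <=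
    #|[set p : n.-tuple G | is_path b a p & has P (b :: p)]|.
  by apply/eqP; rewrite eqn_leq !le.
pose f (p : n.-tuple G) := [tuple of rev (belast a p)].
rewrite -(card_in_imset (f := f)).
  apply/subset_leq_card/subsetP => _ /imsetP[p + ->].
  rewrite !inE => /andP[pp hp]; rewrite is_path_rev //=.
  case/and3P: pp => _ /eqP lp _.
  by move: hp; rewrite -/(has P (a :: p)) -/(has P (b :: _)) -lp -rev_rcons -lastI has_rev.
move=> p q; rewrite !inE => /andP[/and3P[_ /eqP lp _] _].
move=> /andP[/and3P[_ /eqP lq _] _] /(congr1 val) /= /(can_inj revK) eq_b.
apply/val_inj; have: a :: p = a :: q by rewrite !lastI lp lq eq_b.
by case.
Qed.

Lemma sigmaC (G : sgraph) (v w : G) : sigma v w = sigma w v.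
Proof.
rewrite /sigma /shortest_paths (distC v w).
have E a b n : [set p : n.-tuple G | is_path a b p] =
    [set p : n.-tuple G | is_path a b p & has predT (a :: p)].
  by apply/setP=> p; rewrite !inE /= andbT.
by rewrite !E card_pathsC.
Qed.

Lemma sigma_throughC (G : sgraph) (v w x : G) :
  sigma_through v w x = sigma_through w v x.
Proof.
rewrite /sigma_through /shortest_paths (distC v w).
have E a b n : [set p in [set p : n.-tuple G | is_path a b p]
      | [&& x \in a :: p, x != a & x != b]] =
    [set p : n.-tuple G | is_path a b p
      & has (fun y => [&& y == x, x != a & x != b]) (a :: p)].
  apply/setP=> p; rewrite !in_set; congr (_ && _).
  elim: (a :: p) => //= y s IHs; rewrite -IHs in_cons eq_sym.
  by rewrite andb_orl.
rewrite !E card_pathsC; congr #|pred_of_set _|; apply/setP=> p.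
rewrite !in_set; congr (_ && _); apply: eq_has => y.
by rewrite [(x != v) && _]andbC.
Qed.

Lemma sigma_gt0 (G : sgraph) (v w : G) : connected G -> 0 < sigma v w.
Proof.
move=> /(_ v w)/connectP[p0 pp0 ->]; case/shortenP: pp0 => p pp up _.
have szp : size p < #|G|.
  by have := max_card (mem (v :: p)); rewrite (card_uniqP up).
pose a n := [exists q : n.-tuple G, is_path v (last v p) q].
have ha : has a (iota 0 #|G|).
  apply/hasP; exists (size p); first by rewrite mem_iota.
  by apply/existsP; exists (in_tuple p); rewrite /is_path pp eqxx.
have lt_d : dist v (last v p) < #|G|.
  by move: (ha); rewrite has_find size_iota.
have := nth_find 0 ha; rewrite nth_iota // add0n.
case/existsP=> q qp; apply/card_gt0P; exists q; by rewrite inE.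
Qed.

(* Main.v *)
Require Import Defs.
From mathcomp Require Import all_boot all_order all_algebra.

(** Summing the betweenness over all vertices counts, for every pair {v, w},
    the average number of internal vertices of a shortest path from v to w.
    This is at least 1 when v and w are distinct and non-adjacent, so the
    number of edges of the complement is at most the total betweenness,
    which is less than the number of vertices. *)

Import Order.TTheory GRing.Theory Num.Theory.

(** The vertex right after [v] works: it is adjacent to [v], whereas neither [v] nor [w] is. *)
Lemma is_path_internal {G : sgraph} {v w : G} {p : seq G} :
  compl_adj v w -> is_path v w p ->
  exists x, [&& x \in v :: p, x != v & x != w].
Proof.
case/andP=> neq_vw not_vw /and3P[+ + _].
case: p => [|x p] /=; first by rewrite (negPf neq_vw).
case/andP=> adj_vx _ _; exists x; rewrite !inE eqxx orbT /=.
apply/andP; split; apply: contraNneq not_vw => eq_x; last by rewrite -eq_x.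
by rewrite eq_x adj_irr in adj_vx.
Qed.

(** Double counting of pairs (shortest path, internal vertex): every path occurs in at least one. *)
Lemma sigma_le_sum_through (G : sgraph) (v w : G) :
  compl_adj v w -> sigma v w <= \sum_(x : G) sigma_through v w x.
Proof.
move=> vw; rewrite /sigma /sigma_through.
under eq_bigr => x _ do rewrite setIdE -sum1_card big_mkcond /=.
rewrite exchange_big -sum1_card big_mkcond /=; apply: leq_sum => p _.
case: ifP => // p_short; have: is_path v w p by rewrite inE in p_short.
case/(is_path_internal vw)=> x x_int.
by rewrite (bigD1 x) //= in_setI p_short inE x_int.
Qed.

(** Ordering by [enum_rank] matches the sums in [betweenness], allowing a termwise comparison. *)
Definition ordered_nonadjacent (G : sgraph) : {set G * G} :=
  [set p | (enum_rank p.1 < enum_rank p.2) && compl_adj p.1 p.2].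

Lemma card_edges_complement (G : sgraph) :
  #|edges (complement G)| <= #|ordered_nonadjacent G|.
Proof.
apply: leq_trans (leq_imset_card (fun p : G * G => [set p.1; p.2]) _).
apply/subset_leq_card/subsetP => _ /imsetP[[v w] /= + ->].
rewrite inE /= => vw; apply/imsetP.
case: (ltngtP (enum_rank v) (enum_rank w)) => [lt_vw|lt_wv|eq_vw].
- by exists (v, w); rewrite ?inE ?lt_vw.
- exists (w, v); last exact: setUC.
  by rewrite inE /= lt_wv compl_adj_sym.
- by case/andP: vw; rewrite (enum_rank_inj (val_inj eq_vw)) eqxx.
Qed.

Lemma card_ordered_nonadjacent_le {G : sgraph} :
  connected G ->
  (#|ordered_nonadjacent G|%:R <= \sum_(x : G) betweenness x :> rat)%R.
Proof.
move=> connG; rewrite /betweenness exchange_big /=.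
under eq_bigr => v _ do rewrite exchange_big /=.
rewrite pair_big_dep /= -[#|ordered_nonadjacent G|]sum1_card natr_sum.
rewrite [X in (X <= _)%R]big_mkcond [X in (_ <= X)%R]big_mkcond /=.
apply: ler_sum => -[v w] _; rewrite inE /=.
case: (ltnP (enum_rank v) _) => //= _; rewrite -mulr_suml -natr_sum.
(* An adjacent pair contributes 0 on the left, so nonnegativity suffices for it. *)
case: ifP => [vw|_]; last by rewrite divr_ge0 ?ler0n.
rewrite ler_pdivlMr ?ltr0n ?sigma_gt0 // mul1r ler_nat.
exact: sigma_le_sum_through.
Qed.

Theorem corollary5 (G : sgraph) (hG : low_betweenness_bug G) :
  #|edges (complement G)| < #|complement G|.
Proof.
case: hG => b [[connG betw] b_lt1].
apply: leq_ltn_trans (card_edges_complement G) _.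
rewrite -(ltr_nat rat).
apply: le_lt_trans (card_ordered_nonadjacent_le connG) _.
under eq_bigr => x _ do rewrite betw.
(* Both sides are [#|G|]-fold multiples, of [b] and of 1; strictness needs [#|G|] positive. *)
by rewrite sumr_const ltrMn2r b_lt1 andbT (vertex_gt0 G).
Qed.
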